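(* Let $\ell_1,\ell_2>0$, $L=\ell_1+\ell_2$, $D>0$ and $0<c_1,c_2<1$. Let $U_0$ be the delta-like pulse $U_0(x)=1$ for $x=L+D$ and $U_0(x)=0$ for $x\neq L+D$. Let $u$ be the exterior wave for the double-layered scattering problem with initial function $U_0$ (as defined in the context), let $m(t)=u(L+D,t)$ for $t>0$ be the measurement at the detector position $x=L+D$, and set $$m^{(n)} := m\Big(2D + \sum_{j=1}^n\frac{2 \ell_j}{c_j}\Big),\qquad n=0,1,2.$$ Then the three major peaks are given by $$m^{(n)}=\begin{cases} \dfrac12\,\dfrac{c_1-1}{c_1+1}, & n=0,\\[2mm] G_0^{(2,0)}, & n=1,\\[1mm] G_0^{(2,2)}, & n=2,\end{cases}$$ where $G_0^{(2,0)}=G_0\big(D+\tfrac{2\ell_1}{c_1}\big)$ and $G_0^{(2,2)}=G_0\big(D+\tfrac{2\ell_1}{c_1}+\tfrac{2\ell_2}{c_2}\big)$ are the values of the boundary function $G_0$ (the wave at $x=L$, see the context), given by $$G_0^{(2,0)}=\frac{2 c_1 (c_2 - c_1)}{(c_1 +1)^2 (c_2 +c_1)},\qquad G_0^{(2,2)}=- \frac{8c_1^2 c_2}{(c_2 +c_1)^2 (c_1 + 1)^2}.$$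
   Context: $[a]$ denotes the integer part (floor) of the real number $a$; a sum whose upper limit is smaller than its lower limit has no terms and equals $0$. Double-layered scattering problem: the medium occupies $(0,L)$; layer 1 is $(\ell_2,L)$ with length $\ell_1$ and wave speed $c_1$, layer 2 is $(0,\ell_2)$ with length $\ell_2$ and wave speed $c_2$; the exterior $x>L$ has wave speed $1$. The waves $u$ (for $x>L$), $v$ (for $\ell_2<x<L$), $w$ (for $0<x<\ell_2$) satisfy $u_{tt}-u_{xx}=0$, $v_{tt}-c_1^2v_{xx}=0$, $w_{tt}-c_2^2w_{xx}=0$ for $t>0$, the initial conditions $u(x,0)=U_0(x)$, $u_t(x,0)=0$, $v(x,0)=v_t(x,0)=0$, $w(x,0)=w_t(x,0)=0$, the boundary condition $w(0,t)=0$, and continuity of the function and of its spatial derivative across $x=L$ and $x=\ell_2$ for $t>0$. The compatibility condition $U_0(L)=G_0(0)=G_1(0)=0$ is imposed, where $G_0(t)$ and $G_1(t)$ denote the values of the wave at $x=L$ and at $x=\ell_2$, respectively. The solution $u$ is understood through its d'Alembert-type representation $$u(x,t) = \frac{1}{2} U_0 (x+t) + \begin{cases} \tfrac{1}{2} U_0 (x-t), & x> L+t, \\ G_0 (t-x+L) -\tfrac{1}{2} U_0 (t-x+2L), & L<x<L+t, \end{cases}$$ where the boundary functions $G_0,G_1$ solve the system $$G_0 (t) = \frac{c_1}{c_1 +1} U_0 (L+t) -\frac{2}{c_1 +1} \sum_{n=1}^{\left[ \frac{c_1 t }{2\ell_1}\right] } G_0 \left( t -\frac{2n \ell_1}{c_1}\right)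 + \frac{2}{c_1 +1} \sum_{n=0}^{\left[ \frac{c_1 t - \ell_1}{2\ell_1}\right] } G_1 \left( t - \frac{(2n+1) \ell_1}{c_1}\right),$$ $$G_1 (t) = \frac{2c_2}{c_2 +c_1} \sum_{n=0}^{\left[ \frac{c_1 t - \ell_1}{2\ell_1}\right] } G_0 \left( t - \frac{(2n+1) \ell_1}{c_1}\right) -\frac{2c_2}{c_2 +c_1} \sum_{n=1}^{\left[ \frac{c_1 t }{2\ell_1}\right] } G_1 \left( t -\frac{2n \ell_1}{c_1}\right) -\frac{2c_1}{c_2 +c_1} \sum_{n=1}^{\left[ \frac{c_2 t }{2\ell_2}\right] } G_1 \left( t -\frac{2n \ell_2}{c_2}\right),$$ which is the integrated form of the continuity conditions. The ''major peaks'' are the values of $m$ at the arrival times of the single reflections from the interfaces $x=L$, $x=\ell_2$ and $x=0$, respectively.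
   Formalization: The closed form of G_0^{(2,2)} is stated only if ℓ_2/c_2 is not a positive integer multiple of ℓ_1/c_1, or c_1=c_2; otherwise multiple echoes in layer 1 arrive at the same time and the formula fails (ℓ_1=c_1=1/2, ℓ_2=c_2=1/3, D=1 gives -284/675, not -32/75). *)

(* Defs.v *)
From mathcomp Require Import all_boot all_order all_algebra.
From mathcomp Require Import reals.

Set Implicit Arguments.
Unset Strict Implicit.
Unset Printing Implicit Defensive.

Import Order.TTheory GRing.Theory Num.Theory.
Local Open Scope ring_scope.

(* The sum of F n for a <= n <= [x]. The integer [x] may be negative, hence the
   Num.max: the sum is then empty, as it is whenever [x] < a. *)
Definition floor_sum (R : realType) (a : nat) (x : R) (F : nat -> R) : R :=
  \sum_(a <= n < absz (Num.max 0 (Num.floor x + 1))) F n.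

(* The integrated continuity conditions at x = L (first conjunct) and x = l2
   (second conjunct). Only values of G0 and G1 at nonnegative times occur. *)
Definition interface_system (R : realType) (l1 l2 c1 c2 L : R)
    (U0 G0 G1 : R -> R) : Prop :=
  forall t : R, 0 < t ->
    G0 t = c1 / (c1 + 1) * U0 (L + t)
         - 2 / (c1 + 1) *
             floor_sum 1 (c1 * t / (2 * l1))
               (fun n => G0 (t - (2 * n)%N%:R * l1 / c1))
         + 2 / (c1 + 1) *
             floor_sum 0 ((c1 * t - l1) / (2 * l1))
               (fun n => G1 (t - (2 * n + 1)%N%:R * l1 / c1))
    /\
    G1 t = 2 * c2 / (c2 + c1) *
             floor_sum 0 ((c1 * t - l1) / (2 * l1))
               (fun n => G0 (t - (2 * n + 1)%N%:R * l1 / c1))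
         - 2 * c2 / (c2 + c1) *
             floor_sum 1 (c1 * t / (2 * l1))
               (fun n => G1 (t - (2 * n)%N%:R * l1 / c1))
         - 2 * c1 / (c2 + c1) *
             floor_sum 1 (c2 * t / (2 * l2))
               (fun n => G1 (t - (2 * n)%N%:R * l2 / c2)).

(* The d'Alembert-type representation of u in the exterior x > L. It leaves u
   unconstrained on the characteristic x = L + t. *)
Definition dalembert_representation (R : realType) (L : R) (U0 G0 : R -> R)
    (u : R -> R -> R) : Prop :=
  forall x t : R, 0 < t ->
    (L + t < x -> u x t = 1 / 2 * U0 (x + t) + 1 / 2 * U0 (x - t)) /\
    (L < x < L + t ->
       u x t = 1 / 2 * U0 (x + t)
             + (G0 (t - x + L) - 1 / 2 * U0 (t - x + 2 * L))).

(* u is the exterior wave of the double-layered scattering problem with initial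
   function U0, and G0, G1 are the values of the wave at x = L and x = l2. *)
Record double_layer_wave (R : realType) (l1 l2 c1 c2 L : R)
    (U0 G0 G1 : R -> R) (u : R -> R -> R) : Prop := DoubleLayerWave {
  wave_compatibility : [/\ U0 L = 0, G0 0 = 0 & G1 0 = 0];
  wave_interfaces : interface_system l1 l2 c1 c2 L U0 G0 G1;
  wave_exterior : dalembert_representation L U0 G0 u
}.

Definition delta_pulse (R : realType) (a x : R) : R := if x == a then 1 else 0.

(* A round trip through layer 2 lasts as long as k >= 1 round trips through
   layer 1. The echo reflected once at x = 0 then reaches x = L together with
   the one making k + 1 round trips inside layer 1, whose amplitude is a nonzero
   multiple of (c2 - c1)^(k + 1); the value of G0 at that time is their sum. *)
Definition resonant_layers (R : realType) (l1 l2 c1 c2 : R) : Prop :=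
  exists2 k : nat, (0 < k)%N & 2 * l2 / c2 = k%:R * (2 * l1 / c1).

(* Main.v *)
(* Extended by 0 to negative times, G0 and G1 satisfy the interface system at
   all times. Subtracting the system at time t - 2 l1 / c1 from the system at
   time t telescopes the sums over the round trips in layer 1. The sum over the
   round trips in layer 2 only contributes to G1 from time
   D + l1 / c1 + 2 l2 / c2 on, since G1 vanishes before D + l1 / c1. Up to then
   the signals are supported on D plus multiples of l1 / c1, so one step of the
   telescoped recurrences gives the single reflections; the third peak also
   needs G0 (D + 2 l2 / c2) = 0, and the reflected part of
   G1 (D + 2 l2 / c2 - l1 / c1) to vanish, which holds off resonance by the
   support property, and for c1 = c2 because the inner interface is then
   transparent. *)
Require Import Defs.
From mathcomp Require Import all_boot all_order all_algebra.
From mathcomp Require Import reals.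
From mathcomp Require Import ring lra.

Set Implicit Arguments.
Unset Strict Implicit.
Unset Printing Implicit Defensive.

Import Order.TTheory GRing.Theory Num.Theory.
Local Open Scope ring_scope.

(** * Sums whose upper limit is an integer part *)

Lemma eq_floor_sum (R : realType) (a : nat) (x : R) (F F' : nat -> R) :
  (forall n, (a <= n)%N -> n%:R <= x -> F n = F' n) ->
  floor_sum a x F = floor_sum a x F'.
Proof.
move=> eqF; apply: eq_big_nat => n /andP[an nx]; apply: eqF => //.
have [x0|x0] := ltP (Num.floor x + 1) 0.
  by rewrite (max_idPl (ltW x0)) ltn0 in nx.
rewrite (max_idPr x0) -ltz_nat gez0_abs // ltzD1 in nx.
by rewrite floor_ge_int in nx.
Qed.

Lemma floor_sum_recl (R : realType) (a : nat) (x : R) (F : nat -> R) :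
  a%:R <= x -> floor_sum a x F = F a + floor_sum a.+1 x F.
Proof.
move=> ax; have: a%:Z <= Num.floor x by rewrite floor_ge_int.
rewrite -ltzD1 => ax1; rewrite /floor_sum (max_idPr (ltW (le_lt_trans _ ax1))) //.
rewrite big_ltn // -ltz_nat gez0_abs // ltW //.
exact: le_lt_trans ax1.
Qed.

Lemma floor_sum_small (R : realType) (a : nat) (x : R) (F : nat -> R) :
  x < a%:R -> floor_sum a x F = 0.
Proof.
move=> xa; rewrite /floor_sum big_geq // -lez_nat gez0_abs ?le_max ?lexx //.
by rewrite ge_max lezD1 floor_lt_int xa.
Qed.

Lemma floor_sumS (R : realType) (a : nat) (x : R) (F : nat -> R) :
  floor_sum a.+1 x F = floor_sum a (x - 1) (F \o S).
Proof.
have [xa|xa] := ltP x a.+1%:R.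
  by rewrite !floor_sum_small // ltrBlDr natr1.
have x0 : 0 <= Num.floor x.
  by rewrite floor_ge0; apply: le_trans xa.
rewrite /floor_sum.
have -> : Num.floor (x - 1) = Num.floor x - 1.
  by rewrite floorDrz ?rpredN ?int_num1 // -[-1]/((-1)%:~R) intrKfloor.
rewrite subrK.
rewrite (max_idPr x0) max_r ?addr_ge0 //.
case: (Num.floor x) x0 => // n _.
by rewrite -PoszD addn1 /= big_add1.
Qed.

(** * Causal signals and their periodic echoes *)

Definition causal {R : realType} (f : R -> R) := forall t, t <= 0 -> f t = 0.

(** [G0] and [G1] are arbitrary at negative times; the cutoff lets the delay equations be shifted
    freely, and compatibility makes it harmless at time 0. *)
Definition causal_part {R : realType} (f : R -> R) (t : R) : R :=
  if 0 < t then f t else 0.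

Lemma causal_partP (R : realType) (f : R -> R) : causal (causal_part f).
Proof. by move=> t t0; rewrite /causal_part ltNge t0. Qed.

Lemma causal_partE (R : realType) (f : R -> R) (t : R) :
  f 0 = 0 -> 0 <= t -> f t = causal_part f t.
Proof. by move=> f0; rewrite /causal_part le_eqVlt => /predU1P[<-|->//]; rewrite ltxx. Qed.

(** For causal [f] and [tau > 0] this is the full series over n >= 1, since the terms beyond the
    integer part vanish. *)
Definition echoes {R : realType} (f : R -> R) (tau t : R) : R :=
  floor_sum 1 (t / tau) (fun n => f (t - n%:R * tau)).

(** An index shift when [tau <= t]; otherwise both sums are empty and causality kills
    [f (t - tau)]. *)
Lemma echoes_rec (R : realType) (f : R -> R) (tau t : R) :
  0 < tau -> causal f ->
  echoes f tau t = f (t - tau) + echoes f tau (t - tau).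
Proof.
move=> tau0 cf; rewrite /echoes; have [t1|t1] := leP 1 (t / tau).
  rewrite floor_sum_recl // mul1r floor_sumS mulrBl divff ?gt_eqF //.
  congr (_ + _); apply: eq_floor_sum => n _ _ /=.
  by rewrite -natr1 mulrDl mul1r opprD addrA addrAC.
have tt : t < tau by move: t1; rewrite ltr_pdivrMr // mul1r.
rewrite !floor_sum_small ?cf ?addr0 //; first lra.
by rewrite ltr_pdivrMr //; lra.
Qed.

Lemma echoes_eq0 (R : realType) (f : R -> R) (tau t : R) :
  0 < tau -> (forall s, s <= t - tau -> f s = 0) -> echoes f tau t = 0.
Proof.
move=> tau0 f0; rewrite /echoes /floor_sum big_nat big1 // => n /andP[n1 _].
by apply: f0; rewrite lerD2l lerN2 ler_peMl ?(ltW tau0) // ler1n.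
Qed.

Lemma even_delays (R : realType) (G : R -> R) (c l t : R) :
  0 < c -> 0 < l -> G 0 = 0 ->
  floor_sum 1 (c * t / (2 * l)) (fun n => G (t - (2 * n)%N%:R * l / c))
  = echoes (causal_part G) (2 * (l / c)) t.
Proof.
move=> c0 l0 G0; rewrite /echoes.
have -> : t / (2 * (l / c)) = c * t / (2 * l) by field; rewrite !gt_eqF.
apply: eq_floor_sum => n _ nt.
have -> : (2 * n)%N%:R * l / c = n%:R * (2 * (l / c)) by rewrite natrM; ring.
apply: causal_partE => //; rewrite subr_ge0.
have -> : n%:R * (2 * (l / c)) = n%:R * (2 * l) / c by ring.
rewrite ler_pdivlMr ?mulr_gt0 // in nt.
by rewrite ler_pdivrMr // (mulrC t).
Qed.

(** Odd delays are one crossing [l / c] followed by round trips: the upper limit is that of the even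
    sum at time [t - l / c], and the term n = 0 is split off. *)
Lemma odd_delays (R : realType) (G : R -> R) (c l t : R) :
  0 < c -> 0 < l -> G 0 = 0 ->
  floor_sum 0 ((c * t - l) / (2 * l))
    (fun n => G (t - (2 * n + 1)%N%:R * l / c))
  = causal_part G (t - l / c)
    + echoes (causal_part G) (2 * (l / c)) (t - l / c).
Proof.
move=> c0 l0 G0; rewrite -even_delays // mulrBr mulrCA divff ?gt_eqF // mulr1.
have shift n : t - (2 * n + 1)%N%:R * l / c = t - l / c - (2 * n)%N%:R * l / c.
  by rewrite natrD; ring.
have [tl|tl] := leP 0 ((c * t - l) / (2 * l)).
  rewrite floor_sum_recl // shift muln0 !mul0r subr0; congr (_ + _).
    apply: causal_partE => //; rewrite ler_pdivlMr ?mulr_gt0 // mul0r subr_ge0 in tl.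
    by rewrite subr_ge0 ler_pdivrMr // mulrC.
  by apply: eq_floor_sum => n _ _; rewrite shift.
rewrite ltr_pdivrMr ?mulr_gt0 // mul0r in tl.
rewrite !floor_sum_small ?ltr_pdivrMr ?mulr_gt0 //; try lra.
rewrite causal_partP ?addr0 // subr_le0 ler_pdivlMr // mulrC; lra.
Qed.

(** * The interface system as delay equations valid at all times *)

(* a and b are the one-way travel times through the layers, D the time at
   which the pulse reaches x = L. *)
Record echo_system {R : realType} (a b D k p q r : R) (g0 g1 : R -> R) : Prop :=
  EchoSystem {
  echo_causal0 : causal g0;
  echo_causal1 : causal g1;
  echo_eq0 : forall t,
    g0 t = k * delta_pulse D t - p * echoes g0 (2 * a) t
         + p * (g1 (t - a) + echoes g1 (2 * a) (t - a));
  echo_eq1 : forall t,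
    g1 t = q * (g0 (t - a) + echoes g0 (2 * a) (t - a))
         - q * echoes g1 (2 * a) t - r * echoes g1 (2 * b) t
}.

Lemma delta_pulse_neq (R : realType) (a x : R) : x != a -> delta_pulse a x = 0.
Proof. by rewrite /delta_pulse => /negbTE ->. Qed.

(** By the Archimedean property, finitely many steps of length [d] lead from any time down to
    nonpositive times. *)
Lemma delay_ind (R : realType) (d : R) (P : R -> Prop) :
  0 < d -> (forall t, t <= 0 -> P t) ->
  (forall t, (forall s, s <= t - d -> P s) -> P t) -> forall t, P t.
Proof.
move=> d0 P0 PS t.
have Pn n : forall s, s <= n%:R * d -> P s.
  elim: n => [|n IH] s sn; first by apply: P0; rewrite mul0r in sn.
  apply: PS => s' ss'; apply: IH; apply: le_trans ss' _.
  by rewrite -natr1 in sn; lra.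
have [t0|t0] := leP t 0; first exact: P0.
apply: (Pn (Num.bound (t / d))).
rewrite -ler_pdivrMr // ltW //; apply: archi_boundP.
by rewrite divr_ge0 // ltW.
Qed.

Lemma interface_echo_system (R : realType) (l1 l2 L D c1 c2 : R)
    (G0 G1 : R -> R) :
  0 < l1 -> 0 < l2 -> 0 < D -> 0 < c1 -> 0 < c2 -> G0 0 = 0 -> G1 0 = 0 ->
  interface_system l1 l2 c1 c2 L (delta_pulse (L + D)) G0 G1 ->
  echo_system (l1 / c1) (l2 / c2) D (c1 / (c1 + 1)) (2 / (c1 + 1))
    (2 * c2 / (c2 + c1)) (2 * c1 / (c2 + c1)) (causal_part G0) (causal_part G1).
Proof.
move=> l10 l20 D0 c10 c20 G00 G10 sys.
have a0 : 0 < l1 / c1 by rewrite divr_gt0.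
have b0 : 0 < l2 / c2 by rewrite divr_gt0.
split; try exact: causal_partP.
  move=> t; have [t0|t0] := leP t 0; last first.
    rewrite {1}/causal_part t0 (sys t t0).1 even_delays // odd_delays //.
    by rewrite /delta_pulse (inj_eq (addrI L)).
  (* At [t <= 0] every term vanishes, the pulse included because it arrives at [D > 0]. *)
  have tD : t != D by rewrite lt_eqF //; lra.
  rewrite !causal_partP ?delta_pulse_neq ?echoes_eq0 //; try lra;
    by move=> s st; apply: causal_partP; lra.
move=> t; have [t0|t0] := leP t 0; last first.
  by rewrite {1}/causal_part t0 (sys t t0).2 !even_delays // odd_delays.
rewrite !causal_partP ?echoes_eq0 //; try lra;
  by move=> s st; apply: causal_partP; lra.
Qed.

(** * Telescoped recurrences and the signals at early times *)

Lemma echo_step0 (R : realType) (a b D k p q r : R) (g0 g1 : R -> R) (t : R) :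
  0 < a -> echo_system a b D k p q r g0 g1 ->
  g0 t = (1 - p) * g0 (t - 2 * a) + p * g1 (t - a)
       + k * (delta_pulse D t - delta_pulse D (t - 2 * a)).
Proof.
move=> a0 [cg0 cg1 eq0 _]; have a20 : 0 < 2 * a by lra.
have := eq0 t; have := eq0 (t - 2 * a).
rewrite (echoes_rec t a20 cg0) (echoes_rec (t - a) a20 cg1).
rewrite (_ : t - 2 * a - a = t - a - 2 * a); last ring.
move=> e1 e2; lra.
Qed.

(** The lag [2 * a] telescopes only the layer 1 sums; the echoes of period [2 * b] survive as a
    difference. *)
Lemma echo_step1 (R : realType) (a b D k p q r : R) (g0 g1 : R -> R) (t : R) :
  0 < a -> echo_system a b D k p q r g0 g1 ->
  g1 t = (1 - q) * g1 (t - 2 * a) + q * g0 (t - a)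
       - r * (echoes g1 (2 * b) t - echoes g1 (2 * b) (t - 2 * a)).
Proof.
move=> a0 [cg0 cg1 _ eq1]; have a20 : 0 < 2 * a by lra.
have := eq1 t; have := eq1 (t - 2 * a).
rewrite (echoes_rec t a20 cg1) (echoes_rec (t - a) a20 cg0).
rewrite (_ : t - 2 * a - a = t - a - 2 * a); last ring.
move=> e1 e2; lra.
Qed.

Lemma echo_arrival (R : realType) (a b D k p q r : R) (g0 g1 : R -> R) (t : R) :
  0 < a -> 0 < b -> 0 < D -> echo_system a b D k p q r g0 g1 ->
  (t < D -> g0 t = 0) /\ (t < D + a -> g1 t = 0).
Proof.
move=> a0 b0 D0 [cg0 cg1 eq0 eq1].
(* The induction step must exceed neither travel time, so that the delays [a], [2 * a] and [2 * b]
   all reach the induction hypothesis. *)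
have [d [d0 da db]] : exists d, [/\ 0 < d, d <= a & d <= b].
  by exists (Num.min a b); rewrite lt_min a0 b0 !ge_min !lexx orbT.
move: t; apply: (@delay_ind _ d) => // [t t0|t IH].
  by rewrite cg0 ?cg1.
split=> tD.
  rewrite eq0 delta_pulse_neq ?lt_eqF // (IH (t - a) _).2; try lra.
  rewrite !echoes_eq0; try lra; move=> s st.
    by apply: (IH s _).2; lra.
  by apply: (IH s _).1; lra.
rewrite eq1 (IH (t - a) _).1; try lra.
rewrite !echoes_eq0; try lra; move=> s st.
- by apply: (IH s _).2; lra.
- by apply: (IH s _).2; lra.
- by apply: (IH s _).1; lra.
Qed.

(* Before D + a + 2 b nothing has come back from x = 0. *)
Lemma echo_step1_early (R : realType) (a b D k p q r : R) (g0 g1 : R -> R)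
    (t : R) :
  0 < a -> 0 < b -> 0 < D -> echo_system a b D k p q r g0 g1 ->
  t < D + a + 2 * b ->
  g1 t = (1 - q) * g1 (t - 2 * a) + q * g0 (t - a).
Proof.
move=> a0 b0 D0 sys tD; rewrite (echo_step1 _ a0 sys).
rewrite !echoes_eq0; try lra; move=> s st;
  by apply: (echo_arrival s a0 b0 D0 sys).2; lra.
Qed.

(** A delay [a] exchanges the two lattices and a delay [2 * a] preserves each, so the recurrences
    cannot leave them; the source enters at [D] and [D + 2 * a]. *)
Lemma echo_early_support (R : realType) (a b D k p q r : R) (g0 g1 : R -> R)
    (t : R) :
  0 < a -> 0 < b -> 0 < D -> echo_system a b D k p q r g0 g1 ->
  t < D + a + 2 * b ->
  ((forall i : nat, t != D + i%:R * (2 * a)) -> g0 t = 0) /\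
  ((forall i : nat, t != D + a + i%:R * (2 * a)) -> g1 t = 0).
Proof.
move=> a0 b0 D0 sys; move: t; apply: (@delay_ind _ a) => // [t t0 _|t IH tD].
  by rewrite (echo_causal0 sys) ?(echo_causal1 sys).
split=> off.
  rewrite (echo_step0 _ a0 sys).
  rewrite (IH (t - 2 * a) _ _).1 ?(IH (t - a) _ _).2 ?delta_pulse_neq; try lra.
  - by apply: contra_neq (off 1%N) => e; lra.
  - by apply: contra_neq (off 0%N) => e; lra.
  - by move=> i; apply: contra_neq (off i.+1) => e; rewrite -natr1; lra.
  - by move=> i; apply: contra_neq (off i.+1) => e; rewrite -natr1; lra.
rewrite (echo_step1_early a0 b0 D0 sys) //.
rewrite (IH (t - 2 * a) _ _).2 ?(IH (t - a) _ _).1; try lra.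
- by move=> i; apply: contra_neq (off i) => e; lra.
- by move=> i; apply: contra_neq (off i.+1) => e; rewrite -natr1; lra.
Qed.

(* For c1 = c2, that is q = 1, the interface x = l2 reflects nothing. *)
Lemma echo_early_transparent (R : realType) (a b D k p r : R) (g0 g1 : R -> R)
    (t : R) :
  0 < a -> 0 < b -> 0 < D -> echo_system a b D k p 1 r g0 g1 ->
  t < D + a + 2 * b -> g0 t = k * delta_pulse D t.
Proof.
move=> a0 b0 D0 sys; move: t; apply: (@delay_ind _ a) => // [t t0 _|t IH tD].
  by rewrite (echo_causal0 sys) // delta_pulse_neq ?mulr0 // lt_eqF //; lra.
rewrite (echo_step0 _ a0 sys).
rewrite (@echo_step1_early _ _ _ _ _ _ _ _ _ _ (t - a) a0 b0 D0 sys); last lra.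
rewrite (_ : t - a - a = t - 2 * a); last ring.
(* The weights [1 - p] and [p] recombine into [g0 (t - 2 * a)], which cancels the delayed pulse. *)
by rewrite (IH (t - 2 * a)); [ring|lra..].
Qed.

(** * Amplitudes of the single reflections *)

Lemma echo_first (R : realType) (a b D k p q r : R) (g0 g1 : R -> R) :
  0 < a -> 0 < b -> 0 < D -> echo_system a b D k p q r g0 g1 ->
  g0 D = k /\ g1 (D + a) = q * k.
Proof.
move=> a0 b0 D0 sys.
have arr t := echo_arrival t a0 b0 D0 sys.
have g0D : g0 D = k.
  rewrite (echo_step0 _ a0 sys).
  rewrite (arr (D - 2 * a)).1 ?(arr (D - a)).2; try lra.
  rewrite (@delta_pulse_neq _ _ (D - 2 * a)); last by rewrite lt_eqF //; lra.
  by rewrite /delta_pulse eqxx; ring.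
split=> //; rewrite (echo_step1_early a0 b0 D0 sys).
  rewrite (arr (D + a - 2 * a)).2; last lra.
  by rewrite addrK g0D; ring.
lra.
Qed.

(** Three contributions: [(1 - p) * k] from the first peak, [p * q * k] from the inner interface,
    and [- k] from the subtracted pulse. *)
Lemma echo_second (R : realType) (a b D k p q r : R) (g0 g1 : R -> R) :
  0 < a -> 0 < b -> 0 < D -> echo_system a b D k p q r g0 g1 ->
  g0 (D + 2 * a) = k * p * (q - 1).
Proof.
move=> a0 b0 D0 sys.
have [g0D g1D] := echo_first a0 b0 D0 sys.
rewrite (echo_step0 _ a0 sys) addrK g0D.
rewrite (_ : D + 2 * a - a = D + a) ?g1D; last ring.
rewrite (@delta_pulse_neq _ _ (D + 2 * a)); last by rewrite gt_eqF //; lra.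
by rewrite /delta_pulse eqxx; ring.
Qed.

Lemma echo_third (R : realType) (a b D k p q r : R) (g0 g1 : R -> R) :
  0 < a -> 0 < b -> 0 < D -> echo_system a b D k p q r g0 g1 ->
  (forall i : nat, (0 < i)%N -> 2 * b != i%:R * (2 * a)) \/ q = 1 ->
  g0 (D + 2 * a + 2 * b) = - (p * r * q * k).
Proof.
move=> a0 b0 D0 sys nres.
have arr t := echo_arrival t a0 b0 D0 sys.
have [_ g1D] := echo_first a0 b0 D0 sys.
have b20 : 0 < 2 * b by lra.
(* These are the terms by which multiple reflections inside layer 1 could contaminate the third
   peak. *)
have [h0 h1] : g0 (D + 2 * b) = 0 /\ (1 - q) * g1 (D + 2 * b - a) = 0.
  case: nres => [nres|q1].
    have sup t := @echo_early_support _ _ _ _ _ _ _ _ _ _ t a0 b0 D0 sys.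
    rewrite (sup (D + 2 * b) _).1 ?(sup (D + 2 * b - a) _).2 ?mulr0 //; try lra.
      by move=> i; apply: contra_neq (nres i.+1 isT) => e; rewrite -natr1; lra.
    (* On the lattice of [g0], index 0 would force [b = 0]; every other index is a resonance. *)
    case=> [|i]; first by rewrite mul0r addr0 gt_eqF //; lra.
    by apply: contra_neq (nres i.+1 isT) => e; lra.
  rewrite q1 in sys *; rewrite subrr mul0r; split=> //.
  rewrite (echo_early_transparent a0 b0 D0 sys); last lra.
  by rewrite delta_pulse_neq ?mulr0 // gt_eqF //; lra.
rewrite (echo_step0 _ a0 sys).
rewrite !delta_pulse_neq; try by rewrite gt_eqF //; lra.
rewrite (_ : D + 2 * a + 2 * b - 2 * a = D + 2 * b) ?h0; last ring.
rewrite (_ : D + 2 * a + 2 * b - a = D + a + 2 * b); last ring.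
rewrite (echo_step1 _ a0 sys).
rewrite (_ : D + a + 2 * b - 2 * a = D + 2 * b - a) ?h1; last ring.
rewrite (_ : D + a + 2 * b - a = D + 2 * b) ?h0; last ring.
(* The single return from x = 0 is [g1 (D + a)]; the other echoes sample [g1] before its first
   arrival. *)
rewrite (echoes_rec (D + a + 2 * b) b20 (echo_causal1 sys)) addrK g1D.
rewrite !echoes_eq0; try lra; move=> s st; apply: (arr s).2; lra.
Qed.

Theorem proposition2p6 (R : realType) (l1 l2 L D c1 c2 : R)
    (G0 G1 : R -> R) (u : R -> R -> R)
    (hl1 : 0 < l1) (hl2 : 0 < l2) (hL : L = l1 + l2) (hD : 0 < D)
    (hc1 : 0 < c1 < 1) (hc2 : 0 < c2 < 1)
    (hu : double_layer_wave l1 l2 c1 c2 L (delta_pulse (L + D)) G0 G1 u) :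
  let m := fun t : R => u (L + D) t in
  [/\ m (2 * D) = 1 / 2 * ((c1 - 1) / (c1 + 1)),
      m (2 * D + 2 * l1 / c1) = G0 (D + 2 * l1 / c1),
      m (2 * D + (2 * l1 / c1 + 2 * l2 / c2))
        = G0 (D + 2 * l1 / c1 + 2 * l2 / c2),
      G0 (D + 2 * l1 / c1)
        = 2 * c1 * (c2 - c1) / ((c1 + 1) ^+ 2 * (c2 + c1))
    & (~ resonant_layers l1 l2 c1 c2 \/ c1 = c2) ->
      G0 (D + 2 * l1 / c1 + 2 * l2 / c2)
        = - (8 * c1 ^+ 2 * c2 / ((c2 + c1) ^+ 2 * (c1 + 1) ^+ 2))].
Proof.
have [c10 _] := andP hc1; have [c20 _] := andP hc2.
have [[_ G00 G10] sysG repu] := hu.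
have a0 : 0 < l1 / c1 by rewrite divr_gt0.
have b0 : 0 < l2 / c2 by rewrite divr_gt0.
have sys := interface_echo_system hl1 hl2 hD c10 c20 G00 G10 sysG.
have c1n : c1 + 1 != 0 by rewrite gt_eqF //; lra.
have c2n : c2 + c1 != 0 by rewrite gt_eqF //; lra.
have g0E t : 0 < t -> G0 t = causal_part G0 t by rewrite /causal_part => ->.
(* The detector lies behind the characteristic, and the incoming half has already passed. The
   remaining pulse term is nonzero only at [s = D], where it lowers the first peak by 1/2. *)
have mE s : D <= s ->
    u (L + D) (D + s) = G0 s - 1 / 2 * delta_pulse (L + D) (L + s).
  move=> Ds; rewrite (repu _ _ _).2; [|lra..].
  rewrite delta_pulse_neq; last by rewrite gt_eqF //; lra.
  rewrite (_ : D + s - (L + D) + L = s); last ring.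
  by rewrite (_ : D + s - (L + D) + 2 * L = L + s); [ring|ring].
have mE' s : D < s -> u (L + D) (D + s) = G0 s.
  move=> Ds; rewrite mE ?ltW // delta_pulse_neq ?mulr0 ?subr0 //.
  by rewrite gt_eqF // ltrD2l.
move=> m; rewrite /m.
have -> : 2 * l1 / c1 = 2 * (l1 / c1) by ring.
have -> : 2 * l2 / c2 = 2 * (l2 / c2) by ring.
split.
- have -> : 2 * D = D + D by ring.
  rewrite mE // g0E // (echo_first a0 b0 hD sys).1.
  by rewrite /delta_pulse eqxx; field.
- by rewrite -mE'; [congr u; ring|lra].
- by rewrite -mE'; [congr u; ring|lra].
- rewrite g0E ?(echo_second a0 b0 hD sys); last lra.
  by field; rewrite c1n c2n.
- move=> nres; rewrite g0E; last lra.
  rewrite (echo_third a0 b0 hD sys).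
    by field; rewrite c1n c2n.
  (* Equal speeds give [q = 2 * c2 / (c2 + c1) = 1]. *)
  case: nres => [nres|c12]; last by right; rewrite -c12; field; rewrite !gt_eqF // addr_gt0.
  left=> i i0; apply/eqP => e; apply: nres; exists i => //.
  by rewrite -!mulrA.
Qed.
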